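(* The worst-case running time of Zielonka's recursive algorithm on weak parity games with $d$ different priorities, $|V|$ vertices and $|E|$ edges is $\Theta(d\cdot(|V|+|E|))$.
   Context: A parity game $G=(V,E,\mathcal{P},(V_\Diamond,V_\Box))$ consists of a finite vertex set $V$ partitioned into $V_\Diamond$ (owned by player even, $\Diamond$) and $V_\Box$ (owned by player odd, $\Box$), a total edge relation $E\subseteq V\times V$ (write $v\to w$ for $(v,w)\in E$) and a priority function $\mathcal{P}:V\to\mathbb{N}$. Player $\Diamond$ wins an infinite play iff the highest priority occurring infinitely often is even; a vertex is won by player $i$ if $i$ has a strategy winning every consistent play from it; solving means computing the winning regions $(W_\Diamond,W_\Box)$. For $A\subseteq V$, $G\setminus A$ is the game restricted to $V\setminus A$. $\overline{i}$ is the opponent of $i$. The $i$-attractor $\mathit{Attr}_i(U)$ of $U\subseteq V$ is the least superset of $U$ closed under adding vertices of $V_i$ having some successor in the set and vertices of $V_{\overline i}$ all of whose successors are in the set. Zielonka's algorithm $\textsc{Zielonka}(G)$: if $V=\emptyset$ return $(\emptyset,\emptyset)$. Otherwise let $m$ be the maximal priority, $p=\Diamond$ if $m$ even else $p=\Box$, $U=\{v\mid\mathcal{P}(v)=m\}$, $A=\mathit{Attr}_p(U)$, $(W'_\Diamond,W'_\Box)=\textsc{Zielonka}(G\setminus A)$. If $W'_{\overline p}=\emptyset$, return $W_p=A\cup W'_p$, $W_{\overline p}=\emptyset$. Otherwise let $B=\mathit{Attr}_{\overline p}(W'_{\overline p})$, $(W''_\Diamond,W''_\Box)=\textsc{Zielonka}(G\setminus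 B)$, and return $W_p=W''_p$, $W_{\overline p}=W''_{\overline p}\cup B$. A parity game is weak if $\mathcal{P}(v)\ge\mathcal{P}(w)$ for every edge $v\to w$. *)

(* Defs.v *)
(* Plain MathComp. *)
From HB Require Import structures.
From mathcomp Require Import all_boot.

Set Implicit Arguments.
Unset Strict Implicit.
Unset Printing Implicit Defensive.

(* [true] is player even, [false] is player odd, and [~~ i] is the opponent
   of [i]. *)
Definition player := bool.
Definition parity_player (k : nat) : player := ~~ odd k.

Record parity_game := ParityGame {
  vertex :> finType;
  owner : vertex -> player;
  edge : rel vertex;
  priority : vertex -> nat;
  edge_total : forall v, exists w, edge v w }.

Arguments owner {p} _.
Arguments edge {p} _ _.
Arguments priority {p} _.

Definition weak (G : parity_game) : Prop :=
  forall v w : G, edge v w -> priority w <= priority v.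

Definition num_edges (G : parity_game) : nat :=
  #|[set e : G * G | edge e.1 e.2]|.

Definition num_priorities (G : parity_game) : nat :=
  size (undup (codom (@priority G))).

(* A restriction of a game [G] is represented by the set [S] of the vertices
   that are kept. *)
Section Zielonka.

Variable G : parity_game.
Implicit Types (S U X : {set G}) (i : player).

Definition attr_step S i U X : {set G} :=
  U :|: [set v in S | if owner v == i
                      then [exists w in S, edge v w && (w \in X)]
                      else [forall w in S, edge v w ==> (w \in X)]].

Definition attr S i U : {set G} := fixset (attr_step S i U).

Lemma attr_step_mono S i U : {homo attr_step S i U : X Y / X \subset Y}.
Proof.
move=> X Y sXY; apply: setUS; apply/subsetP => v; rewrite !inE.
case/andP=> -> /=; case: ifP => _.
  case/existsP=> w /and3P[Sw vw Xw]; apply/existsP; exists w.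
  by rewrite Sw vw (subsetP sXY).
move/forallP=> vX; apply/forallP => w; apply/implyP => Sw; apply/implyP => vw.
by apply: (subsetP sXY); apply: (implyP (implyP (vX w) Sw)).
Qed.

Lemma attr_fix S i U : attr_step S i U (attr S i U) = attr S i U.
Proof. exact/fixsetK/attr_step_mono. Qed.

Lemma attr_least S i U X : attr_step S i U X \subset X -> attr S i U \subset X.
Proof.
move=> sX; rewrite /attr /fixset; elim: #|G| => [|n IHn]; first exact: sub0set.
exact: subset_trans (attr_step_mono _ _ _ IHn) sX.
Qed.

Lemma sub_attr S i U : U \subset attr S i U.
Proof. by rewrite -attr_fix subsetUl. Qed.

(* The vertices of [X] together with the edges of the restriction to [S] that
   have an endpoint in [X]. *)
Definition touch S X : nat :=
  #|X| + #|[set e : G * G | [&& e.1 \in S, e.2 \in S, edge e.1 e.2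
                              & (e.1 \in X) || (e.2 \in X)]]|.

(* One call of the algorithm on the restriction to [S], where [rec] stands for
   the recursive calls.  The result is the pair of winning regions, indexed by
   the players, and the number of elementary steps.

   The steps are those of an implementation with adjacency lists (in
   both directions), counters of the remaining successors, vertices bucketed
   by priority, and winning regions kept as linked lists:
   - the call itself, including the test for emptiness, costs 1;
   - [A] is found by a backward search from the top bucket and then deleted,
     which visits the vertices of [A] and their incident edges, [touch S A];
   - once [W (~~ p)] is known, only the vertices outside it remain to be
     classified: [B] and the restriction to [S :\: B] are found by scanning
     these vertices and their incident edges, [touch S (S :\: W (~~ p))];
   - the unions that make up the result are disjoint unions of lists, whose
     cost is absorbed by the above.
   Charging every call for the whole of its subgame instead would not be a
   description of this implementation, and gives totals that are quadratic in
   the number of priorities. *)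
Definition zielonka_body (rec : {set G} -> (player -> {set G}) * nat) S :
    (player -> {set G}) * nat :=
  if S == set0 then (fun=> set0, 1) else
  let m := \max_(v in S) priority v in
  let p := parity_player m in
  let U := [set v in S | priority v == m] in
  let A := attr S p U in
  let: (W', t') := rec (S :\: A) in
  if W' (~~ p) == set0 then
    (fun i => if i == p then A :|: W' p else set0, 1 + touch S A + t')
  else
    let B := attr S (~~ p) (W' (~~ p)) in
    let: (W'', t'') := rec (S :\: B) in
    (fun i => if i == p then W'' p else W'' (~~ p) :|: B,
     1 + touch S A + t' + touch S (S :\: W' (~~ p)) + t'').

(* The argument [n] bounds the depth of the recursion; [zielonkaE] shows that
   starting it at [#|S|] yields the unrestricted recursion. *)
Fixpoint zielonka_rec (n : nat) S {struct n} : (player -> {set G}) * nat :=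
  if n is n'.+1 then zielonka_body (zielonka_rec n') S else (fun=> set0, 1).

Definition zielonka S := zielonka_rec #|S| S.

Lemma ltn_card_setD S X : S :&: X != set0 -> #|S :\: X| < #|S|.
Proof.
by move=> SX; rewrite -(cardsID X S) -[X in X < _]add0n ltn_add2r card_gt0.
Qed.

Lemma attr_sub S i U : U \subset S -> attr S i U \subset S.
Proof.
move=> sUS; apply: attr_least; rewrite subUset sUS.
by apply/subsetP => v; rewrite inE => /andP[].
Qed.

Lemma setI_attr_neq0 S i U : U \subset S -> U != set0 -> S :&: attr S i U != set0.
Proof.
move=> sUS /set0Pn[u Uu]; apply/set0Pn; exists u.
by rewrite inE (subsetP sUS) // (subsetP (sub_attr S i U)).
Qed.

Lemma top_neq0 S : S != set0 ->
  [set v in S | priority v == \max_(w in S) priority w] != set0.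
Proof.
case/set0Pn=> v Sv; have S_gt0 : 0 < #|[pred w in S]|.
  by rewrite (cardD1 v) inE Sv.
have [w Sw ->] := eq_bigmax_cond (@priority G) S_gt0.
by apply/set0Pn; exists w; rewrite inE eqxx andbT.
Qed.

Lemma zielonka_rec_sub n S i : (zielonka_rec n S).1 i \subset S.
Proof.
elim: n S i => [|n IHn] S i /=; first exact: sub0set.
rewrite /zielonka_body; case: ifP => _; first exact: sub0set.
set m := \max_(v in S) _; set p := parity_player m.
set A := attr S p _.
have sAS : A \subset S.
  by apply: attr_sub; apply/subsetP => v; rewrite inE => /andP[].
have := IHn (S :\: A); case: (zielonka_rec n _) => W' t' /= sW'.
have sW'S j : W' j \subset S by apply: subset_trans (sW' j) (subsetDl _ _).
case: ifP => _ /=.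
  by case: ifP => _; rewrite ?sub0set // subUset sAS sW'S.
set B := attr S _ _; have sBS : B \subset S by apply: attr_sub.
have := IHn (S :\: B); case: (zielonka_rec n _) => W'' t'' /= sW''.
have sW''S j : W'' j \subset S by apply: subset_trans (sW'' j) (subsetDl _ _).
by case: ifP => _; rewrite ?subUset ?sW''S.
Qed.

Lemma zielonka_rec_fuel n1 n2 S :
  #|S| <= n1 -> #|S| <= n2 -> zielonka_rec n1 S = zielonka_rec n2 S.
Proof.
elim: n1 n2 S => [|n1 IHn] [|n2] S //=.
- by rewrite leqn0 cards_eq0 /zielonka_body => ->.
- by move=> _; rewrite leqn0 cards_eq0 /zielonka_body => ->.
move=> le1 le2; rewrite /zielonka_body; case: eqP => // /eqP S_neq0.
set m := \max_(v in S) _; set p := parity_player m.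
set U := [set v in S | _]; set A := attr S p U.
have IH X : S :&: X != set0 ->
    zielonka_rec n1 (S :\: X) = zielonka_rec n2 (S :\: X).
  move=> /ltn_card_setD ltX.
  by apply: IHn; rewrite -ltnS; apply: leq_trans ltX _.
have sUS : U \subset S by apply/subsetP => v; rewrite inE => /andP[].
rewrite (IH A); last by apply: setI_attr_neq0; rewrite ?top_neq0.
have := zielonka_rec_sub n2 (S :\: A) (~~ p).
case: (zielonka_rec n2 (S :\: A)) => W' t' /= sW'; case: eqP => // /eqP W'_neq0.
rewrite IH //; apply: setI_attr_neq0 => //.
by apply: subset_trans sW' (subsetDl _ _).
Qed.

Theorem zielonkaE S : zielonka S = zielonka_body zielonka S.
Proof.
rewrite {1}/zielonka (@zielonka_rec_fuel _ #|S|.+1) //= /zielonka_body.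
case: eqP => // _; set A := attr S _ _.
have E X : zielonka_rec #|S| (S :\: X) = zielonka (S :\: X).
  by apply: zielonka_rec_fuel; rewrite // subset_leq_card ?subsetDl.
by rewrite E; case: (zielonka _) => W' t' /=; case: ifP => // _; rewrite E.
Qed.

End Zielonka.

Definition running_time (G : parity_game) : nat := (zielonka [set: G]).2.

Definition weak_game_of_size (d n m : nat) (G : parity_game) : Prop :=
  [/\ weak G, num_priorities G = d, #|G| = n & num_edges G = m].

Definition worst_case_time (d n m t : nat) : Prop :=
  (exists2 G, weak_game_of_size d n m G & running_time G = t) /\
  (forall G, weak_game_of_size d n m G -> running_time G <= t).

(* Main.v *)
Require Import Defs.
From mathcomp Require Import all_boot zify.
From Stdlib Require Import Classical.

(** In a weak game the top-priority vertices [U] form their own attractor,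
    because no other vertex has an edge into [U].  So the first recursive call
    is on a game with one priority fewer.  The second one is on a game won
    entirely by the player [p] of the top priority, and on a game won entirely
    by one player the algorithm is linear: at each level one of its two
    recursive calls is trivial.  A level thus costs [O(|V| + |E|)].

    For the lower bound, take an odd vertex of priority 1 with a self-loop as
    its only outgoing edge, and above it vertices owned by player even, with
    self-loops and even priorities, all but one of the higher levels being
    singletons.  Player odd wins just the bottom vertex, so each level rescans
    everything else.  The edges are placed by preference between vertices of
    the lower half of the levels, which contains half of the vertices, so that
    each level of the upper half rescans a constant fraction of the graph.
    A weak game with [n] vertices and [d] priorities never has more edges than
    this shape admits, since the number of pairs of vertices of equal priority
    is largest when all priority classes but one are singletons. *)

Set Implicit Arguments.
Unset Strict Implicit.
Unset Printing Implicit Defensive.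

(** * The upper bound *)

Section UpperBound.

Variable G : parity_game.
Implicit Types (S U X : {set G}) (i p : player).

(** * Restrictions, attractors and traps *)

Definition top S := \max_(v in S) priority v.
Definition topset S : {set G} := [set v in S | priority v == top S].

(** Such restrictions are again parity games. *)
Definition serial S := forall v, v \in S -> exists2 w, w \in S & edge v w.

(* Within [S], player [i] can keep the play in [X]. *)
Definition trap S i X := forall v, v \in X ->
  if owner v == i then exists2 w, w \in X & edge v w
  else forall w, w \in S -> edge v w -> w \in X.

(** Winning is read off the output of the algorithm, so no strategies are built. *)
Definition solo i S := (zielonka S).1 (~~ i) = set0.

Lemma attrP S i U v : reflect
  (v \in U \/ v \in S /\
    if owner v == i then exists2 w, w \in S :&: attr S i U & edge v w
    else forall w, w \in S -> edge v w -> w \in attr S i U)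
  (v \in attr S i U).
Proof.
have E : (v \in attr S i U) = (v \in attr_step S i U (attr S i U)).
  by rewrite attr_fix.
rewrite [X in reflect _ X]E !inE; apply: (iffP orP) => -[|]; try by left.
  case/andP=> Sv H; right; split=> //; move: H; case: ifP => _.
    by case/existsP=> w /and3P[Sw vw Aw]; exists w; rewrite // inE Sw.
  by move/forallP=> H w Sw vw; apply: (implyP (implyP (H w) Sw)).
case=> Sv H; right; rewrite Sv /=; move: H; case: ifP => _.
  by case=> w /setIP[Sw Aw] vw; apply/existsP; exists w; rewrite Sw vw.
by move=> H; apply/forallP => w; apply/implyP => Sw; apply/implyP; apply: H.
Qed.

Lemma attr_ind S i U X : U \subset X ->
  (forall v, v \in S ->
    (if owner v == i then exists2 w, w \in S :&: X & edge v w
     else forall w, w \in S -> edge v w -> w \in X) -> v \in X) ->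
  attr S i U \subset X.
Proof.
move=> sUX closedX; apply: attr_least; rewrite /attr_step subUset sUX /=.
apply/subsetP => v; rewrite inE => /andP[Sv H]; apply: closedX => //.
move: H; case: ifP => _.
  by case/existsP=> w /and3P[Sw vw Xw]; exists w; rewrite // inE Sw.
by move/forallP=> H w Sw vw; apply: (implyP (implyP (H w) Sw)).
Qed.

(** The successors that justify adding a vertex lie in the attractor themselves. This allows running
    the algorithm on [B] alone. *)
Lemma attr_in_attr S i U : U \subset S ->
  attr (attr S i U) i U = attr S i U.
Proof.
move=> sUS; set A := attr S i U.
have sAS : A \subset S by apply: attr_sub.
have sYA : attr A i U \subset A by apply/attr_sub/sub_attr.
apply/eqP; rewrite eqEsubset sYA; apply: attr_ind => [|v Sv H].
  exact: sub_attr.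
have Av : v \in A.
  apply/attrP; right; split=> //; move: H; case: ifP => _.
    by case=> w /setIP[Sw Yw] vw; exists w; rewrite // inE Sw (subsetP sYA).
  by move=> H w Sw vw; apply/(subsetP sYA)/H.
apply/attrP; right; split=> //; move: H; case: ifP => _.
  by case=> w /setIP[_ Yw] vw; exists w; rewrite // inE Yw (subsetP sYA).
by move=> H w /(subsetP sAS) Sw vw; apply: H.
Qed.

Lemma trap_serial S i X : X \subset S -> serial S -> trap S i X -> serial X.
Proof.
move=> sXS totS trX v Xv; move: (trX v Xv); case: ifP => // _ H.
have [w Sw vw] := totS v (subsetP sXS v Xv).
by exists w => //; apply: H.
Qed.

(** A vertex outside the attractor that broke the trap condition would have been attracted. *)
Lemma trap_setD_attr S i U : trap S (~~ i) (S :\: attr S i U).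
Proof.
move=> v /setDP[Sv /negP nAv]; case: ifP => [/eqP ov | /negbT ov].
  apply: NNPP => nex; apply/nAv/attrP; right; split=> //.
  have -> : (owner v == i) = false by rewrite ov; case: (i).
  move=> w Sw vw; apply: contraT => nAw.
  by case: nex; exists w; rewrite // inE nAw.
move=> w Sw vw; rewrite inE Sw andbT; apply/negP => Aw.
apply/nAv/attrP; right; split=> //.
have -> : owner v == i by move: ov; case: (i) (owner v) => [] [].
by exists w; rewrite // inE Sw.
Qed.

Lemma serial_setD_attr S i U : serial S -> serial (S :\: attr S i U).
Proof.
by move=> totS; apply: trap_serial (@trap_setD_attr S i U); rewrite ?subsetDl.
Qed.

(** * Top priorities and the size of subgames *)

Lemma leq_top S v : v \in S -> priority v <= top S.
Proof. exact: (@leq_bigmax_cond _ (mem S) (@priority G)). Qed.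

Lemma topset_sub S : topset S \subset S.
Proof. by apply/subsetP => v; rewrite inE => /andP[]. Qed.

(** Every edge within [S] either meets [X] or survives in [S :\: X], so deletion costs add up along
    the recursion. *)
Lemma touch_split S X : X \subset S ->
  touch S S = touch S X + touch (S :\: X) (S :\: X).
Proof.
move=> sXS; rewrite /touch addnACA; congr (_ + _).
  by rewrite -(cardsID X S) (setIidPr sXS).
set Y := [set e : G * G | _].
rewrite -(cardsID [set e : G * G | (e.1 \in X) || (e.2 \in X)] Y).
congr (_ + _); apply: eq_card => -[v w]; rewrite !inE /=.
  by case: (v \in S) => //=; case: (w \in S) => //=; case: (edge v w).
case: (v \in S); case: (w \in S); case: (edge v w);
  rewrite //= ?andbT ?andbF //=.
by rewrite negb_or; case: (v \in X); case: (w \in X).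
Qed.

Lemma touch_mono S X (S' X' : {set G}) : S \subset S' -> X \subset X' ->
  touch S X <= touch S' X'.
Proof.
move=> sS sX; rewrite leq_add ?subset_leq_card //.
apply/subsetP=> -[v w]; rewrite !inE /=.
case/and4P=> /(subsetP sS) -> /(subsetP sS) -> -> /=.
by case/orP=> /(subsetP sX) ->; rewrite ?orbT.
Qed.

Lemma touch_gt0 S X : X != set0 -> 0 < touch S X.
Proof. by rewrite -card_gt0 => X_gt0; rewrite ltn_addr. Qed.

Lemma zielonka0 : zielonka set0 = (fun=> set0, 1) :> (player -> {set G}) * nat.
Proof. by rewrite zielonkaE /zielonka_body eqxx. Qed.

Lemma zielonka_step S : S != set0 ->
  let p := parity_player (top S) in
  let A := attr S p (topset S) in
  let Z' := zielonka (S :\: A) in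
  let B := attr S (~~ p) (Z'.1 (~~ p)) in
  let Z'' := zielonka (S :\: B) in
  zielonka S =
    if Z'.1 (~~ p) == set0 then
      (fun i => if i == p then A :|: Z'.1 p else set0, 1 + touch S A + Z'.2)
    else (fun i => if i == p then Z''.1 p else Z''.1 (~~ p) :|: B,
          1 + touch S A + Z'.2 + touch S (S :\: Z'.1 (~~ p)) + Z''.2).
Proof.
move=> /negPf nz p A Z' B Z''; rewrite zielonkaE /zielonka_body nz.
rewrite -/(top S) -/p -/(topset S) -/A /Z'' /B /Z'.
case: (zielonka (S :\: A)) => W' t' /=; case: ifP => // _.
by case: (zielonka _).
Qed.

(** Already the chain of first recursive calls deletes every vertex and every edge once. *)
Lemma touch_le_zielonka S : touch S S <= (zielonka S).2.
Proof.
have [k] := ubnP #|S|; elim: k S => // k IHk S; rewrite ltnS => leS.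
have [-> | nz] := eqVneq S set0.
  rewrite zielonka0 /touch cards0 add0n leqW // leqn0 cards_eq0.
  by apply/eqP/setP => e; rewrite !inE.
rewrite zielonka_step //=; set p := parity_player _; set A := attr _ _ _.
have le : touch (S :\: A) (S :\: A) <= (zielonka (S :\: A)).2.
  apply/IHk/(leq_trans _ leS)/ltn_card_setD/setI_attr_neq0/top_neq0 => //.
  exact: topset_sub.
have sA : A \subset S by apply/attr_sub/topset_sub.
rewrite (touch_split sA); case: ifP => _ /=; lia.
Qed.

(** * Removing the top level of a weak game *)

Hypothesis weakG : weak G.

Lemma topset_no_pred S v w : v \in S :\: topset S -> w \in S -> edge v w ->
  w \in S :\: topset S.
Proof.
rewrite !inE => /andP[nUv Sv] Sw /weakG; rewrite Sv Sw /= in nUv *.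
by have := leq_top Sv; rewrite andbT; move: nUv; lia.
Qed.

Lemma serial_setD_topset S : serial S -> serial (S :\: topset S).
Proof.
move=> totS v Lv; have [|w Sw vw] := totS v; first by case/setDP: Lv.
by exists w => //; apply: topset_no_pred vw.
Qed.

(** A vertex below the top has a successor, and by weakness all its successors are below the top, so
    neither player attracts it. *)
Lemma attr_topset S i : serial (S :\: topset S) ->
  attr S i (topset S) = topset S.
Proof.
move=> totL; apply/eqP; rewrite eqEsubset sub_attr andbT.
apply: attr_ind => // v Sv H; apply: contraT => nUv.
have Lv : v \in S :\: topset S by rewrite inE nUv.
move: H; case: ifP => _.
  case=> w /setIP[Sw Uw] vw.
  by have := topset_no_pred Lv Sw vw; rewrite inE Uw.
have [w /setDP[Sw nUw] vw] := totL v Lv.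
by move/(_ w Sw vw); rewrite (negPf nUw).
Qed.

Definition low k S : {set G} := [set v in S | priority v < k].

Lemma low_sub k S : low k S \subset S.
Proof. by apply/subsetP => v; rewrite inE => /andP[]. Qed.

(** The bound [k] need not be attained: it will be the top priority of a larger set, all of whose
    top vertices may have been removed. *)
Lemma topset_below k S : (forall v, v \in S -> priority v <= k) ->
  low k S = S \/
  [/\ S != set0, top S = k & S :\: topset S = low k S].
Proof.
move=> leS; have [->|neq] := eqVneq (low k S) S; [by left | right].
have [v Sv pv] : exists2 v, v \in S & priority v = k.
  apply: NNPP => nex; move/negP: neq; apply; rewrite eqEsubset low_sub.
  apply/subsetP => v Sv; rewrite inE Sv ltn_neqAle leS // andbT.
  by apply/eqP => pv; case: nex; exists v.
have topS : top S = k.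
  apply/eqP; rewrite eqn_leq -{2}pv leq_top // andbT.
  by apply/bigmax_leqP.
split=> //; first by apply/set0Pn; exists v.
apply/setP=> w; rewrite !inE topS; case Sw: (w \in S); rewrite /= ?andbF //.
by rewrite andbT ltn_neqAle leS // andbT.
Qed.

(** The first call leaves the opponent nothing, so the algorithm returns without a second call. *)
Lemma solo_up k S : (forall v, v \in S -> priority v <= k) ->
  serial (low k S) -> solo (parity_player k) (low k S) ->
  solo (parity_player k) S.
Proof.
move=> /topset_below[-> //|[nz topS lowS]] totL soloL.
rewrite /solo zielonka_step // topS attr_topset ?lowS //.
by rewrite soloL eqxx /=; case: (parity_player k).
Qed.

(** The first call gives everything below [k] to the opponent, whose attractor then swallows [S];
    the second call is on the empty game. *)
Lemma solo_down k S : let p := parity_player k in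
  (forall v, v \in S -> priority v <= k) -> serial (low k S) ->
  low k S != set0 -> (zielonka (low k S)).1 (~~ p) = low k S ->
  solo (~~ p) (low k S) -> attr S (~~ p) (low k S) = S -> solo (~~ p) S.
Proof.
move=> p /topset_below[-> //|[nz topS lowS]] totL Lnz WL soloL attrL.
rewrite /solo zielonka_step // topS -/p attr_topset ?lowS //.
by rewrite WL (negPf Lnz) attrL setDv zielonka0 negbK /= eqxx.
Qed.

Lemma trap_low S i X : X \subset S :\: topset S ->
  trap (S :\: topset S) i X -> trap S i X.
Proof.
move=> sX trX v Xv; have := trX v Xv; case: ifP => // _ H w Sw vw.
by apply: (H w _ vw); apply: topset_no_pred vw => //; apply: (subsetP sX).
Qed.

(** * The structure of the computed winning regions *)

Lemma solo_set0 i : solo i set0.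
Proof. by rewrite /solo zielonka0. Qed.

(** The third clause strengthens the induction: rerun on one winning region, the algorithm gives it
    to the same player, which makes the second recursive call predictable. *)
Definition correct S :=
  [/\ forall i, (zielonka S).1 (~~ i) = S :\: (zielonka S).1 i,
      forall i, trap S i ((zielonka S).1 i) &
      forall i, solo i ((zielonka S).1 i)].

Lemma solo_all S i : correct S -> solo i S -> (zielonka S).1 i = S.
Proof.
move=> [part _ _] soloS; have := part (~~ i).
by rewrite negbK soloS setD0.
Qed.

Lemma correct_split S i W1 W0 :
  (zielonka S).1 i = W1 -> (zielonka S).1 (~~ i) = W0 ->
  W1 \subset S -> W0 = S :\: W1 ->
  trap S i W1 -> trap S (~~ i) W0 -> solo i W1 -> solo (~~ i) W0 -> correct S.
Proof.
move=> E1 E0 sW EW tr1 tr0 so1 so0.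
have EW' : W1 = S :\: W0 by rewrite EW setDDr setDv set0U (setIidPr sW).
by case: i => /= in E1 E0 tr1 tr0 so1 so0 *; split=> -[] /=; rewrite ?E1 ?E0.
Qed.

Lemma card_setD_topset S : S != set0 -> #|S :\: topset S| < #|S|.
Proof.
move=> nz; apply: ltn_card_setD; rewrite (setIidPr (topset_sub S)).
exact: top_neq0.
Qed.

Lemma low_top S X : X \subset S -> low (top S) X = X :&: (S :\: topset S).
Proof.
move=> sXS; apply/setP=> v; rewrite !inE; case Xv: (v \in X) => //=.
have Sv := subsetP sXS v Xv; rewrite Sv andbT /= ltn_neqAle.
by rewrite leq_top // andbT.
Qed.

(** The region of [p] in [L] is a trap for [p] in all of [S], so [B] adds only top vertices to the
    opponent's region. What survives is the region of [p] with some top vertices, and [solo_up]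
    applies. *)
Lemma second_call_solo S : let L := S :\: topset S in
  let p := parity_player (top S) in
  let B := attr S (~~ p) ((zielonka L).1 (~~ p)) in
  serial S -> correct L -> B :&: L = (zielonka L).1 (~~ p) /\ solo p (S :\: B).
Proof.
move=> L p; set W0 := (zielonka L).1 (~~ p) => B totS [partL trapL soloL].
have totL : serial L by apply: serial_setD_topset.
have sLS : L \subset S by apply: subsetDl.
set W1 := (zielonka L).1 p in partL trapL soloL *.
have EW0 : W0 = L :\: W1 by apply: partL.
have EW1 : W1 = L :\: W0 by rewrite /W1 -{1}[p]negbK partL.
have sW0L : W0 \subset L by rewrite EW0 subsetDl.
have sW1L : W1 \subset L by rewrite EW1 subsetDl.
have trW1 : trap S p W1 by apply: trap_low (trapL _).
have sW0B : W0 \subset B by apply: sub_attr.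
have BL : B :&: L = W0.
  apply/eqP; rewrite eqEsubset subsetI sW0B sW0L !andbT.
  suff sB : B \subset ~: W1.
    apply/subsetP => v /setIP[Bv Lv]; rewrite EW0 inE Lv andbT.
    by have := subsetP sB v Bv; rewrite inE.
  apply: attr_ind => [|v Sv H]; first by rewrite EW0 setDE subsetIr.
  (* The trap gives [p] a successor in [W1] and confines the opponent to [W1], against both ways of
     being attracted. *)
  rewrite inE; apply/negP => W1v; move: (trW1 v W1v) H.
  have -> : (owner v == ~~ p) = ~~ (owner v == p).
    by case: (owner v) (p) => [] [].
  case: (owner v == p) => /= [[w W1w vw] H | H [w /setIP[Sw nW1w] vw]].
    by have := H w (subsetP (subset_trans sW1L sLS) w W1w) vw; rewrite inE W1w.
  by move: nW1w; rewrite inE H.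
split=> //.
have lowSB : low (top S) (S :\: B) = W1.
  rewrite low_top ?subsetDl // EW1 -BL setIDAC (setIidPr sLS).
  by rewrite setDIr setDv setU0.
apply: solo_up; rewrite ?lowSB; last exact: soloL.
  by move=> v /setDP[Sv _]; apply: leq_top.
exact: trap_serial (trapL _).
Qed.

Lemma zielonka_correct S : serial S -> correct S.
Proof.
have [n] := ubnP #|S|; elim: n S => // n IHn S; rewrite ltnS => leSn totS.
have [->|nz] := eqVneq S set0.
  apply: (@correct_split _ true set0 set0);
    rewrite ?zielonka0 ?sub0set ?setD0 //;
    try exact: solo_set0; by move=> v; rewrite inE.
have totL := serial_setD_topset totS.
have corL : correct (S :\: topset S).
  by apply: IHn => //; apply: leq_trans (card_setD_topset nz) _.
have := zielonka_step nz; set p := parity_player (top S).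
rewrite /= attr_topset //; set U := topset S in totL corL *.
set L := S :\: U in totL corL *.
case: (corL) => partL trapL soloL.
set W1 := (zielonka L).1 p in partL trapL soloL *.
set W0 := (zielonka L).1 (~~ p).
have sUS : U \subset S by apply: topset_sub.
have EW0 : W0 = L :\: W1 by apply: partL.
have EW1 : W1 = L :\: W0 by rewrite /W1 -{1}[p]negbK partL.
have sLS : L \subset S by apply: subsetDl.
have sW0L : W0 \subset L by rewrite EW0 subsetDl.
have np_p : (~~ p == p) = false by case: (p).
case: ifP => [/eqP W0_0 | W0_nz] EZ.
  have EW1L : W1 = L by rewrite EW1 W0_0 setD0.
  apply: (@correct_split _ p S set0); rewrite ?setDv ?EZ /= ?eqxx ?np_p //.
  - by rewrite EW1L -[RHS](setID S U) (setIidPr sUS).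
  - by move=> v Sv; case: ifP => _ //; have := totS v Sv.
  - by move=> v; rewrite inE.
  - by rewrite /solo EZ /= np_p.
  - exact: solo_set0.
set B := attr S (~~ p) W0 in EZ.
have sW0S := subset_trans sW0L sLS.
have sBS : B \subset S by apply: attr_sub.
have sW0B : W0 \subset B by apply: sub_attr.
have trW0 : trap S (~~ p) W0 by apply: trap_low (trapL _).
have [BL soloSB] := second_call_solo totS corL.
rewrite -/p -/W0 -/B in BL soloSB.
have trB : trap S (~~ p) B.
  move=> v /attrP[W0v|[Sv]]; last first.
    case: ifP => // _ [w /setIP[Sw Bw] vw]; by exists w.
  have := trW0 v W0v; case: ifP => _.
    by case=> w W0w vw; exists w => //; apply: (subsetP sW0B).
  by move=> H w Sw vw; apply/(subsetP sW0B)/H.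
have totW i : serial ((zielonka L).1 i).
  apply: (trap_serial _ totL (trapL i)); first exact: zielonka_rec_sub.
have corSB : correct (S :\: B).
  apply: IHn; last exact: serial_setD_attr.
  by apply: leq_trans (ltn_card_setD _) leSn; apply: setI_attr_neq0;
    rewrite ?W0_nz.
(* Below the top, [B] is just [W0], which the opponent also wins when it is played alone and from
   which all of [B] is attracted. *)
have soloB : solo (~~ p) B.
  apply: solo_down; rewrite -/p ?low_top // ?BL ?W0_nz //.
  - by move=> v /(subsetP sBS); apply: leq_top.
  - exact: totW.
  - rewrite solo_all //.
    apply: IHn; last exact: totW.
    apply: leq_ltn_trans (subset_leq_card sW0L) _.
    exact: leq_trans (card_setD_topset nz) _.
  - exact: attr_in_attr.
apply: (@correct_split _ p (S :\: B) B);
  rewrite ?EZ /= ?eqxx ?np_p ?subsetDl //.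
- exact: solo_all.
- by rewrite soloSB set0U.
- by rewrite setDDr setDv set0U (setIidPr sBS).
- by have := @trap_setD_attr S (~~ p) W0; rewrite negbK.
Qed.

(** * Running time on weak games *)

Lemma topset_neq0 S : S != set0 -> topset S != set0.
Proof. exact: top_neq0. Qed.

(** If [i] is the player of the top priority there is no second call; otherwise [B] is all of [S]
    and the second call is on [set0]. Each search costs [touch S (topset S)], which is positive, so
    the factor 4 pays for both and for the constants. *)
Lemma solo_time S i : serial S -> solo i S ->
  (zielonka S).2 <= 1 + 4 * touch S S.
Proof.
have [n] := ubnP #|S|; elim: n S => // n IHn S; rewrite ltnS => leSn totS.
have [->|nz] := eqVneq S set0; first by rewrite zielonka0.
have totL := serial_setD_topset totS.
have leLn := leq_trans (card_setD_topset nz) leSn.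
have IHL : solo i (S :\: topset S) -> _ := IHn _ leLn totL.
have [partL _ _] := zielonka_correct totL.
have splitS := touch_split (topset_sub S).
have U_gt0 : 0 < touch S (topset S) := touch_gt0 _ (topset_neq0 nz).
rewrite /solo => soloS.
have allS : (zielonka S).1 i = S.
  by apply: solo_all => //; apply: zielonka_correct.
have [] := second_call_solo totS (zielonka_correct totL).
move: soloS allS; rewrite zielonka_step // attr_topset //.
set p := parity_player (top S).
case: ifP => [/eqP W0_0 | W0_nz] /=.
  case: (eqVneq i p) => [ip _ _ _ _ | _ _ S0]; last by rewrite -S0 eqxx in nz.
  by rewrite ip in IHL; have := IHL W0_0; lia.
(* If [p] won everything, [B] would be empty, although it contains the opponent's nonempty region of
   the first call. *)
set B := attr _ _ _; case: (eqVneq i p) => [-> | ip].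
  rewrite [~~ p == p]eq_sym; have -> : (p == ~~ p) = false by case: (p).
  move/eqP; rewrite setU_eq0 => /andP[_ /eqP B0].
  have := sub_attr S (~~ p) ((zielonka (S :\: topset S)).1 (~~ p)).
  by rewrite -/B B0 subset0 W0_nz.
have Ei : i = ~~ p by case: (i) (p) ip => [] [].
rewrite Ei negbK eqxx in IHL * => SB0 _ BL soloSB.
have sBS : B \subset S.
  apply: attr_sub; apply: subset_trans (subsetDl S (topset S)).
  exact: zielonka_rec_sub.
(* [second_call_solo] gives [S :\: B] to [p], who wins nothing here. *)
have S_B : S :\: B = set0.
  have corSB : correct (S :\: B) by apply/zielonka_correct/serial_setD_attr.
  by rewrite -[LHS](solo_all corSB soloSB).
have EB : B = S by apply/eqP; rewrite eqEsubset sBS -setD_eq0 S_B eqxx.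
have EW0 : (zielonka (S :\: topset S)).1 (~~ p) = S :\: topset S.
  by rewrite -BL EB (setIidPr (subsetDl _ _)).
have soloL0 : solo (~~ p) (S :\: topset S) by rewrite /solo partL EW0 setDv.
rewrite S_B zielonka0 EW0 setDDr setDv set0U (setIidPr (topset_sub S)) /=.
by have := IHL soloL0; lia.
Qed.

Definition levels S := undup [seq priority v | v <- enum S].

Lemma size_levels_setD_topset S : S != set0 ->
  size (levels (S :\: topset S)) < size (levels S).
Proof.
move=> nz; rewrite -[X in X <= _]/(size (top S :: levels (S :\: topset S))).
apply: uniq_leq_size => [|k]; rewrite /= ?undup_uniq ?andbT.
  rewrite mem_undup; apply/mapP => -[v].
  by rewrite mem_enum !inE => /andP[nUv Sv] E; rewrite Sv E eqxx in nUv.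
rewrite inE !mem_undup => /orP[/eqP -> | /mapP[v]].
  have /set0Pn[v] := topset_neq0 nz; rewrite inE => /andP[Sv /eqP <-].
  by apply: map_f; rewrite mem_enum.
by rewrite mem_enum => /setDP[Sv _] ->; apply: map_f; rewrite mem_enum.
Qed.

Lemma zielonka_time S : serial S ->
  (zielonka S).2 <= 1 + 8 * (size (levels S) * touch S S).
Proof.
have [n] := ubnP #|S|; elim: n S => // n IHn S; rewrite ltnS => leSn totS.
have [->|nz] := eqVneq S set0; first by rewrite zielonka0.
have totL := serial_setD_topset totS.
have IHL := IHn _ (leq_trans (card_setD_topset nz) leSn) totL.
have splitS := touch_split (topset_sub S).
have S_gt0 := touch_gt0 S nz.
have lev := size_levels_setD_topset nz.
have [_ soloSB] := second_call_solo totS (zielonka_correct totL).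
rewrite zielonka_step // attr_topset //.
set p := parity_player (top S) in soloSB *.
(* With [T = touch S S], the reserve [6 * T] covers the second scan, at most [T], and the second
   call, at most [1 + 4 * T] by [solo_time]. *)
have leL : 1 + touch S (topset S) + (zielonka (S :\: topset S)).2 +
    6 * touch S S <= 1 + 8 * (size (levels S) * touch S S).
  have le1 : touch (S :\: topset S) (S :\: topset S) <= touch S S by lia.
  have := leq_mul lev (leqnn (touch S S)).
  have := leq_mul (leqnn (size (levels (S :\: topset S)))) le1.
  move: IHL; rewrite mulSn; lia.
case: ifP => _ /=; first by apply: leq_trans leL; apply: leq_addr.
set B := attr _ _ _ in soloSB *.
have totSB : serial (S :\: B) by apply: serial_setD_attr.
have le2 := solo_time totSB soloSB.
have le3 := touch_mono (subsetDl S B) (subsetDl S B).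
have le4 := touch_mono (subxx S)
  (subsetDl S ((zielonka (S :\: topset S)).1 (~~ p))).
move: leL le2 le3 le4 S_gt0; rewrite -/p; clear.
move: (touch S S) (touch (S :\: B) _) (touch S (S :\: _)) (touch S _)
  => a b c d.
move: (zielonka _).2 (zielonka _).2 (size _) => e f g.
lia.
Qed.

Lemma serial_setT : serial [set: G].
Proof. by move=> v _; have [w vw] := edge_total v; exists w. Qed.

Lemma touch_setT : touch [set: G] [set: G] = #|G| + num_edges G.
Proof.
rewrite /touch cardsT; congr (_ + _); apply: eq_card => e.
by rewrite !inE andbT.
Qed.

Lemma running_time_upper :
  running_time G <= 1 + 8 * (num_priorities G * (#|G| + num_edges G)).
Proof.
rewrite -touch_setT; apply: leq_trans (zielonka_time serial_setT) _.
rewrite leq_add2l leq_mul2l /= leq_mul2r uniq_leq_size ?orbT ?undup_uniq //.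
by move=> k; rewrite !mem_undup => /mapP[v _ ->]; apply: codom_f.
Qed.

End UpperBound.

(** * The maximal number of edges of a weak game *)

(** Swapping matches the non-increasing with the non-decreasing pairs; together these cover all
    pairs and overlap in the pairs of equal value. *)
Lemma card_leq_pairs (T : finType) (S : {set T}) (f : T -> nat) :
  2 * #|[set e : T * T | [&& e.1 \in S, e.2 \in S & f e.2 <= f e.1]]| =
  #|S| ^ 2 + #|[set e : T * T | [&& e.1 \in S, e.2 \in S & f e.1 == f e.2]]|.
Proof.
set P := [set e | _].
set Q := [set e : T * T | [&& e.1 \in S, e.2 \in S & f e.1 <= f e.2]].
have PQ : #|P| = #|Q|.
  have swapI : injective (fun e : T * T => (e.2, e.1)).
    by move=> [a b] [c e] [-> ->].
  rewrite -(card_imset _ swapI); apply: eq_card => -[a b]; rewrite inE /=.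
  apply/imsetP/and3P => [[[c e]] | [Sa Sb ab]].
    by rewrite inE /= => /and3P[? ? ?] [-> ->].
  by exists (b, a); rewrite // inE /= Sb Sa.
rewrite mul2n -addnn {2}PQ -cardsUI; congr (_ + _).
  rewrite -mulnn -cardsX; apply: eq_card => -[a b]; rewrite !inE /=.
  by case: (a \in S); case: (b \in S) => //=; apply: leq_total.
apply: eq_card => -[a b]; rewrite !inE /= eqn_leq.
by case: (a \in S); case: (b \in S); rewrite //= andbC.
Qed.

Lemma sum_fibers (T : finType) (f : T -> nat) (F : nat -> nat) :
  \sum_(k <- undup (codom f)) #|[set u | f u == k]| * F k = \sum_u F (f u).
Proof.
transitivity (\sum_(k <- undup (codom f)) \sum_(u | f u == k) F k).
  by apply: eq_bigr => k _; rewrite sum_nat_const cardsE.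
rewrite (exchange_big_dep predT) //=; apply: eq_bigr => u _.
have fu : f u \in undup (codom f) by rewrite mem_undup codom_f.
rewrite (big_rem (f u)) //= eqxx big1_seq ?addn0 // => k /andP[/eqP <-].
by rewrite mem_rem_uniqF ?undup_uniq.
Qed.

(** The extreme case is one term taking the whole excess [t]: [(t + 1) ^ 2] plus [size s - 1]
    ones. *)
Lemma sum_sq_positive (s : seq nat) (a : nat -> nat) t :
  {in s, forall k, 0 < a k} -> \sum_(k <- s) a k = size s + t ->
  \sum_(k <- s) a k * a k <= size s + 2 * t + t ^ 2.
Proof.
elim: s t => [|x s IHs] t a_gt0; first by rewrite !big_nil.
have ax : 0 < a x by apply: a_gt0; rewrite mem_head.
have as_gt0 : {in s, forall k, 0 < a k}.
  by move=> k sk; apply: a_gt0; rewrite inE sk orbT.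
have les : size s <= \sum_(k <- s) a k.
  by rewrite -sum1_size big_seq [X in _ <= X]big_seq leq_sum.
rewrite !big_cons => E; have := IHs _ as_gt0 (esym (subnKC les)).
move: E les ax; rewrite /=.
move: (\sum_(k <- s) a k * a k) (\sum_(k <- s) a k) (size s) => v u w.
(* [b] is the excess of the first term and [c] that of the rest; the slack is [2 * b * c]. *)
move=> E les ax; have [b Eb] : exists b, a x = b.+1.
  by exists (a x).-1; rewrite prednK.
have [c Ec] : exists c, u = w + c by exists (u - w); rewrite subnKC.
move: E; rewrite {}Ec {}Eb => E; have -> : t = b + c by lia.
rewrite addKn -!mulnn; nia.
Qed.

Lemma card_same_pairsE (T : finType) (f : T -> nat) :
  #|[set e : T * T | f e.1 == f e.2]| = \sum_u #|[set v | f v == f u]|.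
Proof.
rewrite -sum1_card (eq_bigl (fun e => predT e.1 && (f e.1 == f e.2))).
  rewrite -(pair_big_dep predT (fun u v => f u == f v) (fun _ _ => 1)) /=.
  apply: eq_bigr => u _; rewrite sum1_card; apply: eq_card => v.
  by rewrite inE [LHS]unfold_in eq_sym.
by move=> e; rewrite inE.
Qed.

Lemma card_same_pairs (T : finType) (f : T -> nat) t :
  #|T| = size (undup (codom f)) + t ->
  #|[set e : T * T | f e.1 == f e.2]|
    <= size (undup (codom f)) + 2 * t + t ^ 2.
Proof.
move=> cardT; pose a k := #|[set u | f u == k]|.
rewrite card_same_pairsE -(sum_fibers f a); apply: sum_sq_positive.
  move=> k; rewrite mem_undup => /codomP[u ->].
  by apply/card_gt0P; exists u; rewrite inE.
have := sum_fibers f (fun=> 1); rewrite sum1_card cardT => <-.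
by apply: eq_bigr => k _; rewrite muln1.
Qed.

(** Serves to pick an edge set of prescribed size. *)
Lemma card_between (T : finType) (A B : {set T}) k :
  A \subset B -> #|A| <= k <= #|B| ->
  exists X : {set T}, [/\ A \subset X, X \subset B & #|X| = k].
Proof.
move=> sAB; elim: k => [|k IHk] /andP[leA leB].
  by exists A; split=> //; apply/eqP; rewrite -leqn0.
have [eqA|ltA] := eqVneq #|A| k.+1; first by exists A.
have [|X [sAX sXB cX]] := IHk; first by move: ltA leA leB; lia.
have /set0Pn[v] : B :\: X != set0.
  by rewrite setD_eq0; apply/negP => /subset_leq_card; rewrite cX leqNgt leB.
rewrite inE => /andP[nXv Bv]; exists (v |: X).
rewrite cardsU1 nXv cX subUset sub1set Bv sXB; split=> //.
exact: subset_trans sAX (subsetUr _ _).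
Qed.

(** Edges are pairs of non-increasing priority, so both counts above apply. [card_full] shows that
    the bound is attained. *)
Lemma weak_edges_bound (G : parity_game) t : weak G ->
  #|G| = num_priorities G + t ->
  2 * num_edges G <= #|G| ^ 2 + (num_priorities G + 2 * t + t ^ 2).
Proof.
move=> weakG cardG.
have := card_leq_pairs [set: G] (@priority G); rewrite cardsT.
have := card_same_pairs cardG.
have -> : [set e : G * G | priority e.1 == priority e.2] =
  [set e : G * G | [&& e.1 \in [set: G], e.2 \in [set: G]
                     & priority e.1 == priority e.2]].
  by apply/setP=> e; rewrite !inE.
have : num_edges G <= #|[set e : G * G | [&& e.1 \in [set: G],
    e.2 \in [set: G] & priority e.2 <= priority e.1]]|.
  by apply/subset_leq_card/subsetP => e; rewrite !inE; apply: weakG.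
rewrite /num_priorities; lia.
Qed.

Lemma leq_card_num_edges (G : parity_game) : #|G| <= num_edges G.
Proof.
have nextP v : exists w, edge v w := @edge_total G v.
pose next v := xchoose (nextP v).
have nextI : injective (fun v => (v, next v)) by move=> v w [].
rewrite -(card_codom nextI); apply/subset_leq_card/subsetP => _ /codomP[v ->].
by rewrite inE /=; apply: (xchooseP (nextP v)).
Qed.

Lemma num_priorities_le (G : parity_game) : num_priorities G <= #|G|.
Proof. by rewrite (leq_trans (size_undup _)) // size_codom. Qed.

Lemma leq_card_interval n (P : pred nat) a c : a + c <= n ->
  (forall i, a <= i < a + c -> P i) -> c <= #|[set u : 'I_n | P u]|.
Proof.
move=> le_n Pac; have lt_n (i : 'I_c) : a + i < n.
  by apply: leq_trans le_n; rewrite ltn_add2l.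
pose g (i : 'I_c) := Ordinal (lt_n i).
have gI : injective g by move=> i j [] /addnI; apply: val_inj.
rewrite -[X in X <= _]card_ord -(card_codom gI).
apply/subset_leq_card/subsetP => _ /codomP[i ->].
by rewrite inE Pac //= leq_addr ltn_add2l ltn_ord.
Qed.

(** Turns the upper bound on running times into a slowest game of each size. *)
Lemma exists_max (P : nat -> Prop) b : (exists t, P t) ->
  (forall t, P t -> t <= b) -> exists2 t, P t & forall t', P t' -> t' <= t.
Proof.
elim: b => [|b IHb] exP leP.
  by case: exP => t Pt; exists t => // t' /leP; rewrite leqn0 => /eqP ->.
have [Pb|nPb] := classic (P b.+1); first by exists b.+1.
apply: IHb => // t Pt; rewrite -ltnS ltn_neqAle leP // andbT.
by apply/eqP => tb; apply: nPb; rewrite -tb.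
Qed.

(** * Slow games *)

(* Vertex 0 is alone on level 0; truncated subtraction puts the vertices
   1, ..., N on level 1, and every later vertex is alone on its level. *)
Definition level (N i : nat) : nat := if i == 0 then 0 else (i - N).+1.

Section Ladder.

Variables n N : nat.
Variable E : {set 'I_n.+1 * 'I_n.+1}.
Hypothesis loopsE : forall v, (v, v) \in E.
Hypothesis levelE : forall e, e \in E -> level N e.2 <= level N e.1.

Lemma ladder_total (v : 'I_n.+1) : exists w, (v, w) \in E.
Proof. by exists v. Qed.

(** [maxn 1] gives level 0 the odd priority 1; all other levels get positive even priorities. *)
Definition ladder : parity_game :=
  @ParityGame 'I_n.+1 (fun v => v != ord0) (fun v w => (v, w) \in E)
    (fun v => maxn 1 (level N v).*2) ladder_total.

(** * The algorithm on a ladder *)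

Implicit Types S : {set ladder}.

Lemma ladder_weak : weak ladder.
Proof. by move=> v w /levelE /=; lia. Qed.

Lemma num_edges_ladder : num_edges ladder = #|E|.
Proof. by apply: eq_card => -[v w]; rewrite inE. Qed.

(** Without the bottom vertex all priorities are even, so [p] is even in every call and the first
    call leaves odd nothing. *)
Lemma zielonka_ladder_even S : ord0 \notin S -> solo true S.
Proof.
have [k] := ubnP #|S|; elim: k S => // k IHk S; rewrite ltnS => leSk nS0.
have [->|nz] := eqVneq S set0; first exact: solo_set0.
have pT : parity_player (top S) = true.
  have /set0Pn[v] := topset_neq0 nz; rewrite inE => /andP[Sv /eqP <-].
  rewrite /parity_player /= /level; case: eqP => [v0|_].
    by move: nS0; rewrite (_ : ord0 = v) ?Sv //; apply: val_inj.
  by rewrite (maxn_idPr _) ?odd_double // doubleS.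
rewrite /solo zielonka_step // pT /=.
set A := attr _ _ _; have -> : (zielonka (S :\: A)).1 false = set0.
  apply: IHk; last by rewrite inE (negPf nS0) andbF.
  apply: leq_trans leSk; apply/ltn_card_setD/setI_attr_neq0/topset_neq0 => //.
  exact: topset_sub.
by rewrite eqxx.
Qed.

Definition below k : {set ladder} := [set v : ladder | level N v <= k].

Lemma serial_below S : serial S.
Proof. by move=> v Sv; exists v => //; apply: loopsE. Qed.

Lemma below0 : below 0 = [set ord0].
Proof.
by apply/setP=> v; rewrite !inE leqn0 /level -val_eqE /=; case: (nat_of_ord _).
Qed.

Lemma zielonka_below0 : (zielonka (below 0)).1 false = [set ord0].
Proof.
have nz : below 0 != set0 by rewrite below0 -cards_eq0 cards1.
have top0 : top (below 0) = 1 by rewrite below0 /top big_set1.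
have sU := topset_sub (below 0).
have E0 : topset (below 0) = below 0.
  by apply/setP=> v; rewrite inE top0 below0 inE; case: eqP => // ->.
rewrite zielonka_step // top0 attr_topset ?E0 ?setDv ?zielonka0 /=.
- by rewrite eqxx /= setU0 below0.
- exact: ladder_weak.
exact: serial_below.
Qed.

Lemma below_mono j k : j <= k -> below j \subset below k.
Proof. by move=> lejk; apply/subsetP => v; rewrite !inE => /leq_trans ->. Qed.

(** The first call is on [below k], where odd wins only the bottom vertex, so everything else is
    scanned again before a second call that even wins. *)
Lemma zielonka_belowS k (v : 'I_n.+1) : level N v = k.+1 ->
  (zielonka (below k)).1 false = [set ord0] ->
  (zielonka (below k.+1)).1 false = [set ord0] /\
  touch (below k.+1) (below k.+1 :\ ord0) + (zielonka (below k)).2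
    <= (zielonka (below k.+1)).2.
Proof.
move=> lv Wk; set S := below k.+1.
have lowS : low k.+1.*2 S = below k.
  apply/setP=> w; rewrite !inE /=; lia.
have leS w : w \in S -> priority w <= k.+1.*2 by rewrite inE /=; lia.
case: (topset_below leS) => [|[nz topS]].
  by move/setP/(_ v); rewrite lowS !inE lv ltnn leqnn.
rewrite lowS => topL.
have E0 : ([set ord0 : ladder] == set0) = false by rewrite -cards_eq0 cards1.
have S0 : [set ord0] \subset S by rewrite sub1set inE.
(* Every other vertex belongs to even and can stay on its self-loop. *)
have BE : attr S false [set ord0] = [set ord0].
  apply/eqP; rewrite eqEsubset sub_attr andbT; apply: attr_ind => // w Sw.
  rewrite inE /=; case: (eqVneq w ord0) => //= w0 H.
  by have := H w Sw (loopsE w); rewrite inE (negPf w0).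
have pT : parity_player (top S) = true.
  by rewrite topS /parity_player odd_double.
have totL : serial (S :\: topset S) by apply: serial_below.
rewrite zielonka_step // pT (attr_topset ladder_weak) // topL /= Wk E0 BE /=.
have -> : (zielonka (S :\ ord0)).1 false = set0.
  by apply: zielonka_ladder_even; rewrite !inE eqxx.
by rewrite set0U; split=> //; lia.
Qed.

Variable D : nat.
Hypothesis level_onto : forall k, k <= D -> exists v : 'I_n.+1, level N v = k.

Lemma zielonka_below k : k <= D -> (zielonka (below k)).1 false = [set ord0].
Proof.
elim: k => [|k IHk] leD; first exact: zielonka_below0.
have [v lv] := level_onto leD.
by case: (zielonka_belowS lv (IHk (ltnW leD))).
Qed.

(** Each of the [r.+1] levels from [h.+1] on rescans at least [below h.+1] without the bottom
    vertex. *)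
Lemma zielonka_below_time h r : h.+1 + r <= D ->
  r.+1 * touch (below h.+1) (below h.+1 :\ ord0)
    <= (zielonka (below (h.+1 + r))).2.
Proof.
elim: r => [|r IHr] leD.
  have [v lv] := level_onto leD; rewrite addn0 in leD lv *.
  have [_] := zielonka_belowS lv (zielonka_below (ltnW leD)); rewrite mul1n.
  by apply: leq_trans; apply: leq_addr.
have [v lv] := level_onto leD; rewrite addnS in leD lv *.
have [_] := zielonka_belowS lv (zielonka_below (ltnW leD)).
apply: leq_trans; rewrite mulSn leq_add ?IHr //; last exact: ltnW.
have sB : below h.+1 \subset below (h.+1 + r).+1.
  by apply/below_mono/leqW/leq_addr.
by apply: touch_mono; rewrite ?setSD.
Qed.

(* The self-loop at the bottom vertex is the only untouched edge. *)
Lemma touch_below h : 1 < #|below h| ->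
  #|below h| + #|[set e in E | (e.1 \in below h) && (e.2 \in below h)]|
    <= 2 * touch (below h) (below h :\ ord0).
Proof.
set S := below h => S_gt1; set Eh := [set e in E | _]; rewrite /touch.
set F := [set e | _].
have S0 : ord0 \in S by rewrite inE.
have := cardsD1 ord0 S; rewrite S0.
have leS : #|S| <= #|Eh|.
  have loopI : injective (fun v : ladder => (v, v)) by move=> v w [].
  rewrite -(card_imset _ loopI).
  apply/subset_leq_card/subsetP => _ /imsetP[v Sv ->].
  by rewrite inE /= loopsE Sv.
have leE : #|Eh| <= 1 + #|F|.
  rewrite -(cards1 (ord0 : ladder, ord0 : ladder)).
  apply: leq_trans (leq_card_setU _ _).
  apply/subset_leq_card/subsetP => -[v w]; rewrite !inE /= => /and3P[-> -> ->].
  by rewrite -pair_eqE /= !andbT; case: eqVneq; case: eqVneq.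
move: leS leE S_gt1; move: #|S| #|Eh| #|F| #|S :\ ord0| => a b c e; lia.
Qed.

End Ladder.

(** * Slow ladders with prescribed numbers of vertices, edges and priorities *)

Section SlowLadder.

Variables n d : nat.
Hypotheses (d_gt1 : 1 < d) (led : d <= n.+1).

(** Level 0 and levels 2 to [d.-1] take [d.-1] of the [n.+1] vertices; the others form level 1. *)
Let N := n.+2 - d.

Lemma level_onto k : k <= d.-1 -> exists v : 'I_n.+1, level N v = k.
Proof.
move=> lek; case: k lek => [|k] lek; first by exists ord0.
have lt : N + k < n.+1 by rewrite /N; lia.
exists (Ordinal lt); rewrite /level /= /N.
by case: eqP; lia.
Qed.

Lemma level_max (v : 'I_n.+1) : level N v <= d.-1.
Proof.
have := ltn_ord v; rewrite /level /N.
by case: eqP; lia.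
Qed.

Definition full : {set 'I_n.+1 * 'I_n.+1} :=
  [set e | [&& e.1 \in [set: 'I_n.+1], e.2 \in [set: 'I_n.+1]
             & level N e.2 <= level N e.1]].

(** Level 1 yields at least [N ^ 2] pairs of equal level, and every other vertex at least the pair
    with itself. *)
Lemma card_full :
  n.+1 ^ 2 + (d + 2 * (n.+1 - d) + (n.+1 - d) ^ 2) <= 2 * #|full|.
Proof.
rewrite (card_leq_pairs _ (fun v : 'I_n.+1 => level N v)).
rewrite cardsT card_ord leq_add2l.
have -> : [set e : 'I_n.+1 * 'I_n.+1 | [&& e.1 \in [set: 'I_n.+1],
    e.2 \in [set: 'I_n.+1] & level N e.1 == level N e.2]] =
  [set e : 'I_n.+1 * 'I_n.+1 | level N e.1 == level N e.2].
  by apply/setP=> e; rewrite !inE.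
rewrite (card_same_pairsE (fun v : 'I_n.+1 => level N v)).
pose C := [set v : 'I_n.+1 | level N v == 1].
have leC : N <= #|C|.
  apply: (@leq_card_interval _ (fun i => level N i == 1) 1).
    by rewrite /N; lia.
  by move=> i /andP[i_gt0 ltN]; rewrite /level; case: (i =P 0); lia.
have leCn : #|C| + #|~: C| = n.+1 by rewrite cardsC card_ord.
rewrite (bigID (mem C)) /=.
have -> : \sum_(i in C) #|[set v : 'I_n.+1 | level N v == level N i]| =
    #|C| * #|C|.
  rewrite -sum_nat_const; apply: eq_bigr => i; rewrite inE => /eqP ->.
  by [].
have : #|~: C| <=
    \sum_(i | i \notin C) #|[set v : 'I_n.+1 | level N v == level N i]|.
  rewrite -sum1_card (eq_bigl (fun i => i \notin C)).
    by apply: leq_sum => i _; apply/card_gt0P; exists i; rewrite inE.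
  by move=> i; rewrite inE.
move: leC leCn; move: (\sum_(i | _) _) #|C| #|~: C| => x y z.
rewrite /N -mulnn; nia.
Qed.

Lemma num_priorities_ladder (E : {set 'I_n.+1 * 'I_n.+1})
    (loopsE : forall v, (v, v) \in E) :
  num_priorities (ladder N loopsE) = d.
Proof.
pose s := [seq maxn 1 k.*2 | k <- iota 0 d].
have us : uniq s by rewrite map_inj_in_uniq ?iota_uniq // => j k _ _; lia.
suff /perm_size : perm_eq (undup (codom (@priority (ladder N loopsE)))) s.
  by rewrite size_map size_iota.
apply: uniq_perm; rewrite ?undup_uniq // => k; rewrite mem_undup.
apply/codomP/mapP => [[v ->] | [j]].
  exists (level N v) => //; rewrite mem_iota /=.
  by have := level_max v; lia.
rewrite mem_iota /= add0n => ltj ->.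
have [|v <-] := @level_onto j; first by lia.
by exists v.
Qed.

Let h := d./2.
Let S : {set 'I_n.+1} := [set v : 'I_n.+1 | level N v <= h].
Let inner : {set 'I_n.+1 * 'I_n.+1} :=
  [set e | [&& e.1 \in S, e.2 \in S & level N e.2 <= level N e.1]].
Let loops : {set 'I_n.+1 * 'I_n.+1} := [set (v, v) | v : 'I_n.+1].

Lemma slow_ladder m : n.+1 <= m ->
  2 * m <= n.+1 ^ 2 + (d + 2 * (n.+1 - d) + (n.+1 - d) ^ 2) ->
  exists2 G, weak_game_of_size d n.+1 m G &
    d * (n.+1 + m) <= 32 * running_time G.
Proof.
move=> le_nm le_m.
have h_gt0 : 0 < h by rewrite /h; lia.
have card_loops : #|loops| = n.+1 by rewrite card_imset ?card_ord // => v w [].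
have sLF : loops :|: inner \subset full.
  apply/subsetP=> e; rewrite !inE => /orP[/imsetP[v _ ->] //=|].
  by case/and3P.
have leS : N + h <= #|S|.
  apply: (@leq_card_interval _ (fun i => level N i <= h) 0).
    by rewrite /N /h; lia.
  by move=> i lti; rewrite /level; case: (i =P 0); lia.
(* Level 1 lies in the lower half, and the levels above it are singletons. *)
have leS2 : n.+1 <= 2 * #|S| by move: leS; rewrite /N /h; lia.
have lowS : #|S| ^ 2 <= 2 * #|inner|.
  by rewrite (card_leq_pairs S (fun v : 'I_n.+1 => level N v)) leq_addr.
pose Eh (E : {set 'I_n.+1 * 'I_n.+1}) :=
  [set e in E | (e.1 \in S) && (e.2 \in S)].
have [E [sLE sEF cE leE]] : exists E : {set 'I_n.+1 * 'I_n.+1},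
    [/\ loops \subset E, E \subset full, #|E| = m &
        n.+1 + m <= 8 * (#|S| + #|Eh E|)].
  have leEh (E : {set 'I_n.+1 * 'I_n.+1}) : loops \subset E -> #|S| <= #|Eh E|.
    move=> sLE; have loopI : injective (fun v : 'I_n.+1 => (v, v)).
      by move=> v w [].
    rewrite -(card_imset _ loopI).
    apply/subset_leq_card/subsetP => _ /imsetP[v Sv ->].
    by rewrite inE /= Sv andbT (subsetP sLE) // imset_f.
  (* With few edges, only loops are placed outside the lower half, at most one for each vertex of
     [~: S]. *)
  have [le1|lt1] := leqP m #|loops :|: inner|.
    have [|E [sLE sE cE]] :=
      @card_between _ loops (loops :|: inner) m (subsetUl _ _).
      by rewrite card_loops le_nm.
    exists E; split=> //; first exact: subset_trans sE sLF.
    have leE : #|E| <= #|Eh E| + #|~: S|.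
      have loopI : injective (fun v : 'I_n.+1 => (v, v)) by move=> v w [].
      rewrite -(card_imset (mem (~: S)) loopI).
      apply: leq_trans (leq_card_setU _ _).
      apply/subset_leq_card/subsetP => e Ee.
      have := subsetP sE e Ee; rewrite !inE Ee /=.
      case/orP=> [/imsetP[v _ Ev]|/and3P[-> -> //]].
      rewrite {}Ev /=; case: leqP => //= ltv;
      by apply: imset_f; rewrite inE inE -ltnNge.
    have := cardsC S; rewrite card_ord.
    by have := leEh E sLE; move: leE; rewrite cE; lia.
  (* Otherwise all of [inner] is used, and [m <= n.+1 ^ 2 <= 4 * #|S| ^ 2 <= 8 * #|inner|]. *)
  have [|E [sE sEF cE]] := @card_between _ (loops :|: inner) full m sLF.
    by rewrite ltnW //= -(leq_pmul2l (ltn0Sn 1)) (leq_trans le_m card_full).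
  have sLE := subset_trans (subsetUl _ _) sE.
  exists E; split=> //.
  have lowE : #|inner| <= #|Eh E|.
    apply/subset_leq_card/subsetP => e in_e; rewrite inE (subsetP sE) /=.
      by move: in_e; rewrite inE => /and3P[-> ->].
    by rewrite inE in_e orbT.
  have le_mn : m <= n.+1 * n.+1.
    by rewrite -cE -[X in X * _]card_ord -[X in _ * X]card_ord -card_prod
      max_card.
  have := leEh E sLE; move: lowE lowS leS2 le_mn; rewrite -mulnn.
  by move: #|Eh E| #|inner| #|S| => a b c; nia.
have loopsE v : (v, v) \in E by rewrite (subsetP sLE) // imset_f.
have levelE e : e \in E -> level N e.2 <= level N e.1.
  by move/(subsetP sEF); rewrite !inE.
exists (ladder N loopsE).
  split; first exact: ladder_weak.
  - exact: num_priorities_ladder.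
  - exact: card_ord.
  by rewrite num_edges_ladder.
have hE : h = h.-1.+1 by rewrite prednK.
have leD : h.-1.+1 + (d.-1 - h) <= d.-1 by rewrite prednK // subnKC // /h; lia.
have := @zielonka_below_time _ N E loopsE levelE d.-1 level_onto _ _ leD.
have -> : h.-1.+1 + (d.-1 - h) = d.-1 by rewrite prednK // subnKC // /h; lia.
rewrite -hE.
have -> : below N loopsE d.-1 = [set: ladder N loopsE].
  by apply/setP=> v; rewrite !inE level_max.
have h_lt : 1 < #|below N loopsE h| by apply: leq_trans leS; rewrite /N /h; lia.
have := touch_below h_lt.
rewrite -/(running_time _) -/(Eh E).
move: leE; rewrite -[#|below N loopsE h|]/#|S|.
move: (running_time _) (touch _ _) #|S| #|Eh E| => t u a b.
(* The constant 32 is 8 from [leE], times 2 from [touch_below], times 2 because only the upper half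
   of the levels is counted. *)
have : d <= 2 * (d.-1 - h).+1 by rewrite /h; lia.
move: (d.-1 - h).+1 => r; nia.
Qed.

End SlowLadder.

(** * Matching the two bounds *)

Lemma leq_size_running_time (G : parity_game) :
  #|G| + num_edges G <= running_time G.
Proof. by rewrite -touch_setT; apply: touch_le_zielonka. Qed.

Theorem theorem2 :
  exists c C : nat, [/\ 0 < c, 0 < C &
    forall d n m : nat, 0 < n ->
      (exists G : parity_game, weak_game_of_size d n m G) ->
      exists t : nat, [/\ worst_case_time d n m t,
        d * (n + m) <= c * t &
        t <= C * (d * (n + m))]].
Proof.
(* 32 comes from [slow_ladder]; 9 is the 8 of the upper bound plus 1 for its additive constant, as
   [d] and [n] are positive. *)
exists 32, 9; split=> // d n m n_gt0 [G sizeG].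
have upper G' : weak_game_of_size d n m G' ->
    running_time G' <= 9 * (d * (n + m)).
  move=> [weakG' <- cG' <-]; have := running_time_upper weakG'; rewrite cG'.
  have d_gt0 : 0 < num_priorities G'.
    have /card_gt0P[v _] : 0 < #|G'| by rewrite cG'.
    have : priority v \in undup (codom (@priority G')).
      by rewrite mem_undup codom_f.
    by rewrite /num_priorities; case: (undup _).
  nia.
have [||t [G' sizeG' <-] maxG'] :=
    @exists_max (fun t => exists2 G', weak_game_of_size d n m G'
                                    & running_time G' = t)
      (9 * (d * (n + m))).
- by exists (running_time G), G.
- by move=> _ [G' sizeG' <-]; apply: upper.
exists (running_time G'); split; last exact: upper.
- by split; [exists G' | move=> G'' sG''; apply: maxG'; exists G''].
have leG' G'' : weak_game_of_size d n m G'' ->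
    running_time G'' <= running_time G'.
  by move=> sG''; apply: maxG'; exists G''.
case: (sizeG) => weakG dG nG mG.
have [d_gt1|d_le1] := ltnP 1 d.
  clear upper maxG' sizeG sizeG'.
  case: n n_gt0 leG' nG => // n _ leG' nG.
  have led : d <= n.+1 by rewrite -dG -nG; apply: num_priorities_le.
  have [||G'' sG'' le] := @slow_ladder n d d_gt1 led m.
  - by rewrite -nG -mG; apply: leq_card_num_edges.
  - have := @weak_edges_bound G (n.+1 - d) weakG.
    by rewrite nG dG mG subnKC //; apply.
  by apply: leq_trans le _; rewrite leq_mul2l leG'.
(* With at most one priority the required lower bound is linear, and any game of this size meets
   it. *)
have := leq_size_running_time G; rewrite nG mG => le1.
have := leG' G sizeG; nia.
Qed.
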